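(* Let $(\mathbb{R}^n,g)$ be a pseudo-Euclidean space, $n\geq 3$, with coordinates $x=(x_1,\dots,x_n)$ and $g_{ij}=\delta_{ij}\varepsilon_i$, $\varepsilon_i\in\{1,-1\}$. Let $\xi=\sum_{i=1}^n\alpha_ix_i$ with $\alpha_i\in\mathbb{R}$ not all zero, where either $\sum_{i=1}^n\varepsilon_i\alpha_i^2=\varepsilon_{i_0}\in\{1,-1\}$ or $\sum_{i=1}^n\varepsilon_i\alpha_i^2=0$. Let $\varphi=\varphi(\xi)$ and $f=f(\xi)$ be smooth functions of $\xi$ with $f$ positive and $\varphi$ nowhere vanishing, let $\overline g=\frac1{\varphi^2}g$, and let $(F^m,g_F)$, $m\ge 1$, be a semi-Riemannian Einstein manifold with constant Ricci curvature $\lambda_F$. Let $\lambda\in\mathbb{R}$. Then the warped product $M=(\mathbb{R}^n,\overline g)\times_fF^m$ is Einstein with constant Ricci curvature $\lambda$ if and only if $f$ and $\varphi$ satisfy (primes denoting derivatives with respect to $\xi$): (i) whenever $\sum_{i=1}^n\varepsilon_i\alpha_i^2=\varepsilon_{i_0}$, $$\begin{cases}(n-2)f\varphi''-m\varphi f''-2m\varphi'f'=0,\\[2pt] \displaystyle\sum_{k=1}^n\varepsilon_k\alpha_k^2\,\big[f\varphi\varphi''-(n-1)f\varphi'^2+m\varphi\varphi'f'\big]=\lambda f,\\[2pt] \displaystyle\sum_{k=1}^n\varepsilon_k\alpha_k^2\,\big[-f\varphi^2f''+(n-2)f\varphi\varphi'f'-(m-1)\varphi^2f'^2\big]=\lambda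 f^2-\lambda_F;\end{cases}$$ (ii) whenever $\sum_{i=1}^n\varepsilon_i\alpha_i^2=0$, $$(n-2)f\varphi''-m\varphi f''-2m\varphi'f'=0\quad\text{and}\quad \lambda=\lambda_F=0.$$
   Context: A semi-Riemannian manifold $(N,h)$ is Einstein with constant Ricci curvature $\lambda\in\mathbb{R}$ if $\mathrm{Ric}_h=\lambda h$. For semi-Riemannian manifolds $(B,g_B)$, $(F,g_F)$ and a smooth function $f>0$ on $B$, the warped product $B\times_fF$ is the product manifold $B\times F$ with the metric $g_B+f^2g_F$ (pullbacks by the projections being understood). When $m=1$, the fiber is $F=\mathbb{R}$ and $\lambda_F=0$. Functions of $\xi$ are regarded as functions on $\mathbb{R}^n$ by composition with $x\mapsto\sum_i\alpha_ix_i$. *)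

(* Defs.v *)
From HB Require Import structures.
From mathcomp Require Import all_boot all_order all_algebra.
From mathcomp Require Import all_classical all_reals all_analysis.
Set Implicit Arguments.
Unset Strict Implicit.
Unset Printing Implicit Defensive.
Import Order.TTheory GRing.Theory Num.Theory.
Import numFieldNormedType.Exports.
Local Open Scope ring_scope.
Local Open Scope classical_set_scope.

Definition smooth_fun (R : realType) (f : R -> R) : Prop :=
  forall (k : nat) (x : R), derivable (f^`(k)) x 1.

Section Coordinates.
Context {R : realType} {m : nat}.
Implicit Types (U : set 'rV[R]_m) (F : 'rV[R]_m -> R) (g : 'rV[R]_m -> 'M[R]_m).

Definition pderiv (i : 'I_m) F : 'rV[R]_m -> R :=
  fun u => 'D_(delta_mx 0 i) F u.

(* F is of class C^k on U; only meaningful for U open. *)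
Fixpoint class_C (k : nat) U F : Prop :=
  match k with
  | 0 => {in U, continuous F}
  | k'.+1 => (forall u, U u -> differentiable F u) /\
             (forall i, class_C k' U (pderiv i F))
  end.

Definition smooth_on U F : Prop := forall k, class_C k U F.

Definition christoffel g (k i j : 'I_m) : 'rV[R]_m -> R := fun u =>
  2^-1 * \sum_(l < m) invmx (g u) k l *
    (pderiv i (fun v => g v j l) u + pderiv j (fun v => g v i l) u
     - pderiv l (fun v => g v i j) u).

(* The sign convention is the one making round spheres positively curved. *)
Definition ricci g (u : 'rV[R]_m) : 'M[R]_m := \matrix_(i, j)
  (\sum_(k < m) (pderiv k (christoffel g k i j) u
                 - pderiv j (christoffel g k i k) u)
   + \sum_(k < m) \sum_(l < m)
       (christoffel g k k l u * christoffel g l i j u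
        - christoffel g k j l u * christoffel g l i k u)).

End Coordinates.

(* An atlas on a space, with the components of a (0,2)-tensor field in each of
   its charts: chart a maps chart_dom a onto chart_img a, and param a is its
   inverse.  The values of chart a, param a and metric a outside chart_dom a,
   resp. chart_img a, are irrelevant.  The conditions that these data form a
   semi-Riemannian manifold are in semi_riemannian. *)
Record metric_atlas (R : realType) (m : nat) := MetricAtlas {
  carrier :> topologicalType;
  chart_index : Type;
  chart_dom : chart_index -> set carrier;
  chart : chart_index -> carrier -> 'rV[R]_m;
  param : chart_index -> 'rV[R]_m -> carrier;
  metric : chart_index -> 'rV[R]_m -> 'M[R]_m }.

Section SemiRiemannian.
Context {R : realType} {m : nat} (M : metric_atlas R m).
Implicit Types a b : chart_index M.

Definition chart_img a : set 'rV[R]_m := chart a @` chart_dom a.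

Definition transition_dom a b : set 'rV[R]_m :=
  chart a @` (chart_dom a `&` chart_dom b).

Definition transition a b : 'rV[R]_m -> 'rV[R]_m := chart b \o param a.

Definition smooth_manifold : Prop :=
  [/\ [set: M] !=set0, hausdorff_space M & @second_countable M] /\
  [/\ forall p : M, exists a, chart_dom a p,
      forall a, [/\ open (chart_dom a), open (chart_img a),
        {in chart_dom a, cancel (chart a) (param a)},
        {in chart_dom a, continuous (chart a)} &
        {in chart_img a, continuous (param a)}] &
      forall a b (j : 'I_m),
        smooth_on (transition_dom a b) (fun u => transition a b u 0 j)].

(* Points are row vectors, so 'J f u has (i, j) entry (d f_j / d u_i)(u) and the
   tensor law g_ij = sum_kl (d v_k / d u_i) (d v_l / d u_j) g'_kl reads
   g = J g' J^T. *)
Definition semi_riemannian : Prop :=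
  smooth_manifold /\
  [/\ forall a (i j : 'I_m), smooth_on (chart_img a) (fun u => metric a u i j),
      forall a u, chart_img a u -> (metric a u)^T = metric a u,
      forall a u, chart_img a u -> metric a u \in unitmx &
      forall a b u, transition_dom a b u ->
        let J := 'J (transition a b) u in
        metric a u = J *m metric b (transition a b u) *m J^T].

Definition einstein (lam : R) : Prop :=
  semi_riemannian /\
  forall a u, chart_img a u -> ricci (metric a) u = lam *: metric a u.

End SemiRiemannian.

Section Constructions.
Context {R : realType}.

Definition pseudo_euclidean (n : nat) (eps : 'I_n -> R) : metric_atlas R n :=
  @MetricAtlas R n 'rV[R]_n unit (fun=> setT) (fun=> id) (fun=> id)
    (fun _ _ => diag_mx (\row_i eps i)).

Definition conformal (n : nat) (B : metric_atlas R n) (phi : B -> R) :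
    metric_atlas R n :=
  @MetricAtlas R n B (chart_index B) (@chart_dom R n B) (@chart R n B)
    (@param R n B)
    (fun a u => (phi (param a u) ^+ 2)^-1 *: metric a u).

Definition warped_product (n m : nat) (B : metric_atlas R n) (f : B -> R)
    (F : metric_atlas R m) : metric_atlas R (n + m) :=
  @MetricAtlas R (n + m) (B * F)%type (chart_index B * chart_index F)%type
    (fun c => chart_dom c.1 `*` chart_dom c.2)
    (fun c p => row_mx (chart c.1 p.1) (chart c.2 p.2))
    (fun c w => (param c.1 (lsubmx w), param c.2 (rsubmx w)))
    (fun c w => block_mx
       (metric c.1 (lsubmx w)) 0
       0 (f (param c.1 (lsubmx w)) ^+ 2 *: metric c.2 (rsubmx w))).

End Constructions.

(* Main.v *)
Require Import Defs.
From HB Require Import structures.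
From mathcomp Require Import all_boot all_order all_algebra.
From mathcomp Require Import all_classical all_reals all_analysis.
From mathcomp Require Import ring.
Set Implicit Arguments.
Unset Strict Implicit.
Unset Printing Implicit Defensive.
Import Order.TTheory GRing.Theory Num.Theory.
Import numFieldNormedType.Exports.
Local Open Scope ring_scope.
Local Open Scope classical_set_scope.

(** The theorem is the computation of the Ricci tensor of the metric
      g = phi(xi)^-2 eps + f(xi)^2 g_F
    on R^n x F, followed by the remark that its components decouple.

    Write p = phi'/phi and q = f'/f, and S = sum_i eps_i alpha_i^2.  Every
    Christoffel symbol of g is a function of xi times a function on the fiber:
      Gamma^k_ij = -p (d_ki alpha_j + d_kj alpha_i
                       - eps_k eps_i d_ij alpha_k),
      Gamma^c_ia = q alpha_i d_ca,
      Gamma^k_ab = - eps_k alpha_k phi^2 f f' (g_F)_ab,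
      Gamma^c_ab = the Christoffel symbol of g_F,
    with i, j, k along R^n and a, b, c along F; the other symbols vanish
    ([christoffel_lll] to [christoffel_rrr]).  Such products are differentiated
    factor by factor, and contracting gives
      Ric_ij = alpha_i alpha_j H(xi) + eps_i d_ij S K(xi),
      Ric_ia = 0,
      Ric_ab = (Ric_F)_ab - S L(xi) (g_F)_ab,
    where H, K, L are [hess_coef], [base_coef], [fiber_coef]; see [ricci_ll],
    [ricci_lr], [ricci_rl] and [ricci_rr].

    Hence g is Einstein iff for all i, j
      alpha_i alpha_j H + eps_i d_ij (S K - lam / phi^2) = 0
    and lamF - S L = lam f^2.  In dimension at least two the tensors
    alpha_i alpha_j and eps_i d_ij are linearly independent when alpha is not
    zero, so the first condition splits into H = 0 and S K = lam / phi^2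
    ([base_tensor_eq0], [einstein_warpedP]).  Clearing denominators gives the
    three differential equations, whatever the value of S; when S = 0 the last
    two read lam f = 0 and lam f^2 = lamF, that is lam = lamF = 0.

    Being Einstein includes being a semi-Riemannian manifold, so the converse
    also needs the product atlas to be one ([semi_riemannian_warped]).  There
    the transition maps are the identity times those of F, and smoothness
    follows from the closure of the classes C^k under the ring operations,
    inversion, and composition with the projections. *)

(** * Topology of products *)
Lemma hausdorff_prod (T U : topologicalType) :
  hausdorff_space T -> hausdorff_space U -> hausdorff_space (T * U)%type.
Proof.
move=> hT hU [p1 p2] [q1 q2] clpq; congr pair.
- apply: hT => A B nA nB.
  have [] := clpq (A `*` setT) (B `*` setT).
  + by exists (A, setT) => //; split => //; exact: filterT.
  + by exists (B, setT) => //; split => //; exact: filterT.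
  by move=> [a b] [[/= Aa _] [/= Ba _]]; exists a.
- apply: hU => A B nA nB.
  have [] := clpq (setT `*` A) (setT `*` B).
  + by exists (setT, A) => //; split => //; exact: filterT.
  + by exists (setT, B) => //; split => //; exact: filterT.
  by move=> [a b] [[/= _ Aa] [/= _ Ba]]; exists b.
Qed.

Lemma open_setX (T U : topologicalType) (A : set T) (B : set U) :
  open A -> open B -> open (A `*` B).
Proof.
rewrite !openE => oA oB [x y] [/= Ax By].
by exists (A, B) => //; split; [exact: oA|exact: oB].
Qed.

Lemma second_countable_prod (T U : topologicalType) :
  @second_countable T -> @second_countable U -> @second_countable (T * U)%type.
Proof.
move=> [B cB [oB bB]] [C cC [oC bC]].
exists [set A.1 `*` A.2 | A in B `*` C].
  by apply: (sub_countable (card_image_le _ _)); exact: countableX.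
split.
  move=> _ [[P Q] [/= BP CQ] <-].
  by apply: open_setX; [exact: oB|exact: oC].
move=> [x y] A [[P Q] [/= nP nQ] PQA].
have [P' [BP' P'x] P'P] := bB _ _ nP.
have [Q' [CQ' Q'y] Q'Q] := bC _ _ nQ.
exists (P' `*` Q'); first by split=> //; exists (P', Q').
by move=> [a b] [/= /P'P Pa /Q'Q Qb]; exact: PQA.
Qed.

(** The boxes with rational centre and side 2/(k+1) form a countable basis. *)
Lemma second_countable_rV (R : realType) (n : nat) :
  @second_countable 'rV[R]_n.
Proof.
pose b (q : 'rV[rat]_n * nat) := 
  [set v : 'rV[R]_n | forall j, `|ratr (q.1 0 j) - v 0 j| < q.2.+1%:R^-1].
exists (range b).
  by apply: (sub_countable (card_image_le _ _)); exact: countableP.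
have openb q : open (b q).
  rewrite openE => v bv; rewrite /interior.
  have nbj j : nbhs v
      [set w : 'rV[R]_n | `|ratr (q.1 0 j) - w 0 j| < q.2.+1%:R^-1].
    have := @coord_continuous R 1 n 0 j v.
    move=> cv; have := bv j; rewrite -subr_gt0 => e0.
    have /(_ _ _ e0) := (cvgrPdist_lt _ _).1 cv.
    apply: filterS => w /= vw; rewrite -(subrKA (v 0 j)).
    by rewrite (le_lt_trans (ler_normD _ _))// addrC -ltrBrDr.
  exact: (@filter_forall _ 'I_n _ _ _ nbj).
split; first by move=> _ [q _ <-].
move=> v A /nbhs_ballP[e /= e0 eA].
have [k ke] : exists k, k.+1%:R^-1 < e / 2.
  exists (Num.truncn (e / 2)^-1).
  by rewrite invf_plt ?posrE ?divr_gt0 ?truncnS_gt.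
have k0 : 0 < k.+1%:R^-1 :> R by [].
have /choice[q qv] : forall j, exists q : rat, `|ratr q - v 0 j| < k.+1%:R^-1.
  move=> j.
  have /rat_in_itvoo[q /itvP qv] : v 0 j - k.+1%:R^-1 < v 0 j + k.+1%:R^-1.
    by rewrite ltrBlDr -addrA ltrDl addr_gt0.
  by exists q; rewrite ltr_distl !qv.
exists (b (\row_j q j, k)).
  by split; [exists (\row_j q j, k)|move=> j /=; rewrite mxE].
move=> w bw; apply: eA; split => // i j; rewrite ord1 /ball /=.
have := bw j; rewrite /= mxE => bwj.
rewrite -(subrKA (ratr (q j))) (le_lt_trans (ler_normD _ _))//.
rewrite [e]splitr ltrD// ?(lt_trans _ ke)//.
by rewrite distrC.
Qed.

(** * Partial derivatives and the classes C^k *)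

Section DirectionalDerivatives.
Context {R : realType}.

(** A directional derivative only sees the function along a line, so it may be
    computed in another space where the restriction to a line is the same.  It
    yields the partial derivatives of functions that factor through a linear
    map, with no differentiability assumption on the outer function. *)
Lemma eq_derive_along (V V' W : normedModType R) (F : V -> W) (G : V' -> W)
    (u v : V) (u' v' : V') :
  (forall s : R, F (s *: v + u) = G (s *: v' + u')) ->
  'D_v F u = 'D_v' G u'.
Proof.
move=> FG; rewrite /derive.
suff -> : (fun s : R => s^-1 *: ((F \o shift u) (s *: v) - F u))
  = (fun s => s^-1 *: ((G \o shift u') (s *: v') - G u')) by [].
apply/funext => s /=.
by rewrite FG; have := FG 0; rewrite !scale0r !add0r => ->.
Qed.

Lemma deriveZ_dir (h : R -> R) (t b : R) :
  derivable h t 1 -> 'D_b h t = b * h^`()%classic t.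
Proof.
move=> /derivable1_diffP dh; rewrite derive1E !deriveE//.
by rewrite -[in LHS](mulr1 b) [LHS]linearZ.
Qed.

End DirectionalDerivatives.

Section PartialDerivatives.
Context {R : realType} {N : nat}.
Implicit Types (F G : 'rV[R]_N -> R) (u : 'rV[R]_N).

Lemma near_eq_pderiv (i : 'I_N) F G u :
  (\forall v \near u, F v = G v) -> pderiv i F u = pderiv i G u.
Proof. exact: near_eq_derive. Qed.

Lemma pderiv_cst (i : 'I_N) (c : R) u : pderiv i (fun=> c) u = 0.
Proof. exact: derive_cst. Qed.

Lemma pderivD (i : 'I_N) F G u : differentiable F u -> differentiable G u ->
  pderiv i (fun v => F v + G v) u = pderiv i F u + pderiv i G u.
Proof.
by move=> dF dG; apply: (@deriveD _ _ _ F G); exact: diff_derivable.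
Qed.

Lemma pderivM (i : 'I_N) F G u : differentiable F u -> differentiable G u ->
  pderiv i (fun v => F v * G v) u = pderiv i F u * G u + F u * pderiv i G u.
Proof.
move=> dF dG; rewrite /pderiv (@deriveM _ _ F G); try exact: diff_derivable.
by rewrite addrC; congr (_ + _); rewrite mulrC.
Qed.

Lemma pderivV (i : 'I_N) F u : F u != 0 -> differentiable F u ->
  pderiv i (fun v => (F v)^-1) u = - ((F u)^-1 * ((F u)^-1 * pderiv i F u)).
Proof.
move=> F0 dF; rewrite /pderiv (@deriveV _ _ F)//; last exact: diff_derivable.
by rewrite scaleNr mulrA -invfM -expr2.
Qed.

Lemma pderiv_coord (i j : 'I_N) u :
  pderiv i (fun v => v 0 j) u = (j == i)%:R.
Proof.
rewrite /pderiv (@eq_derive_along _ _ _ _ _ id _ _ (u 0 j) (j == i)%:R).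
  exact: derive_id.
by move=> s; rewrite !mxE /= .
Qed.

End PartialDerivatives.

Section DifferentiabilityClasses.
Context {R : realType} {N : nat}.
Implicit Types (U : set 'rV[R]_N) (F G : 'rV[R]_N -> R).

Lemma class_CW k U F : class_C k.+1 U F -> class_C k U F.
Proof.
elim: k F => [|k ih] F [dF CF].
  by move=> u; rewrite inE => Uu; apply: differentiable_continuous; exact: dF.
by split=> // i; exact: ih (CF i).
Qed.

(** The expansion that defines the differential is asymptotic at [u], hence
    insensitive to the values away from [u]. *)
Lemma near_eq_differentiable F G u :
  (\forall v \near u, F v = G v) -> differentiable F u -> differentiable G u.
Proof.
move=> FG /diff_locallyP[dFc /eqaddoP dF].
have dG : G \o shift u = cst (G u) + 'd F u +o_ 0 id.
  apply/eqaddoP => e e0.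
  have FG0 : \forall h \near (0 : 'rV[R]_N), F (h + u) = G (h + u).
    by move: FG; rewrite (near_shift 0) subr0; apply: filterS.
  move: (dF e e0) FG0; apply: filterS2 => h /= dFh FGh.
  by rewrite -(nbhs_singleton FG) !fctE /= -FGh.
by apply/diff_locallyP; rewrite (diff_unique dFc dG).
Qed.

(** Openness lets an equality on [U] pass to partial derivatives; this is how
    the product and quotient rules, which hold on [U] only, enter the
    induction on [k]. *)
Lemma eq_class_C k U F G : open U -> (forall u, U u -> F u = G u) ->
  class_C k U F -> class_C k U G.
Proof.
move=> oU.
have nearU F' G' u : (forall u, U u -> F' u = G' u) -> U u ->
    \forall v \near u, F' v = G' v.
  move=> FG Uu; have nU : nbhs u U by apply: open_nbhs_nbhs.
  exact: (@filterS _ _ _ U).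
elim: k F G => [|k ih] F G FG.
  move=> cF u; rewrite inE => Uu.
  rewrite /continuous_at -(FG u Uu).
  have Ft : F v @[v --> u] --> F u by apply: cF; rewrite inE.
  exact: (cvg_trans (near_eq_cvg (nearU F G u FG Uu)) Ft).
move=> [dF CF]; split=> [u Uu|i].
  by apply: near_eq_differentiable (dF u Uu); exact: nearU.
by apply: ih (CF i) => u Uu; apply: near_eq_pderiv; exact: nearU.
Qed.

Lemma class_C_cst k U (c : R) : class_C k U (fun=> c).
Proof.
elim: k c => [|k ih] c; first by move=> u _; exact: cst_continuous.
split=> [u _|i]; first exact: differentiable_cst.
suff -> : pderiv i (fun=> c) = fun=> 0 by exact: ih.
by apply/funext => u; exact: pderiv_cst.
Qed.

Lemma class_C_coord k U (j : 'I_N) : class_C k U (fun v => v 0 j).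
Proof.
case: k => [|k]; first by move=> u _; exact: coord_continuous.
split=> [u _|i]; first exact: differentiable_coord.
suff -> : pderiv i (fun v : 'rV[R]_N => v 0 j) = fun=> ((j == i)%:R : R)
  by exact: class_C_cst.
by apply/funext => u; exact: pderiv_coord.
Qed.

Lemma class_CD k U F G : open U ->
  class_C k U F -> class_C k U G -> class_C k U (fun v => F v + G v).
Proof.
move=> oU; elim: k F G => [|k ih] F G.
  by move=> cF cG u Uu; apply: continuousD; [exact: cF|exact: cG].
move=> [dF CF] [dG CG]; split=> [u Uu|i].
  by apply: differentiableD; [exact: dF|exact: dG].
apply: (eq_class_C oU _ (ih _ _ (CF i) (CG i))) => u Uu.
by rewrite pderivD//; [exact: dF|exact: dG].
Qed.

Lemma class_CM k U F G : open U ->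
  class_C k U F -> class_C k U G -> class_C k U (fun v => F v * G v).
Proof.
move=> oU; elim: k F G => [|k ih] F G.
  by move=> cF cG u Uu; apply: continuousM; [exact: cF|exact: cG].
move=> CF' CG'; have [dF CF] := CF'; have [dG CG] := CG'.
split=> [u Uu|i].
  by apply: differentiableM; [exact: dF|exact: dG].
apply: (eq_class_C oU (F := fun u => pderiv i F u * G u + F u * pderiv i G u)).
  by move=> u Uu; rewrite pderivM//; [exact: dF|exact: dG].
by apply: class_CD => //; apply: ih; by [exact: CF|exact: CG|exact: class_CW].
Qed.

(** The derivative of [F^-1] is [- F^-1 * F^-1 * F'], so class [C^k] for the
    inverse gives class [C^k.+1] through the product rule alone. *)
Lemma class_CV k U F : open U -> (forall u, U u -> F u != 0) ->
  class_C k U F -> class_C k U (fun v => (F v)^-1).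
Proof.
move=> oU F0; elim: k => [|k ih].
  move=> cF u Uu; apply: continuousV; last exact: cF.
  by apply: F0; rewrite -inE.
move=> CF'; have [dF CF] := CF'.
split=> [u Uu|i].
  by apply: differentiableV; [exact: dF|exact: F0].
apply: (eq_class_C oU
  (F := fun u => -1 * ((F u)^-1 * ((F u)^-1 * pderiv i F u)))).
  by move=> u Uu; rewrite pderivV ?mulN1r//; [exact: F0|exact: dF].
have CFV : class_C k U (fun v => (F v)^-1) by apply: ih; exact: class_CW.
apply: class_CM => //; first exact: class_C_cst.
by do 2![apply: class_CM => //]; exact: CF.
Qed.

End DifferentiabilityClasses.

(** * Functions of a linear form and functions of the fiber coordinates *)

Section RidgeFunctions.
Context {R : realType} {N : nat}.
Implicit Types (beta : 'I_N -> R) (h : R -> R) (u : 'rV[R]_N).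

Definition lin_form beta u : R := \sum_i beta i * u 0 i.

Lemma lin_formDZ beta (i : 'I_N) (s : R) u :
  lin_form beta (s *: delta_mx 0 i + u) = s * beta i + lin_form beta u.
Proof.
rewrite /lin_form; under eq_bigr do rewrite !mxE /= mulrDr.
rewrite big_split /=; congr (_ + _).
rewrite (bigD1 i)//= eqxx mulr1 big1 ?addr0 1?mulrC// => j /negPf ->.
by rewrite !mulr0.
Qed.

Lemma differentiable_lin_form beta u : differentiable (lin_form beta) u.
Proof.
pose f i (v : 'rV[R]_N) : R := beta i * v 0 i.
have df i : differentiable (f i) u.
  apply: (@differentiableM _ _ (fun=> beta i)); first exact: differentiable_cst.
  exact: differentiable_coord.
have -> : lin_form beta = \sum_i f i by apply/funext => v; rewrite fct_sumE.
exact: differentiable_sum.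
Qed.

Lemma differentiable_ridge beta h u : derivable h (lin_form beta u) 1 ->
  differentiable (fun v => h (lin_form beta v)) u.
Proof.
move=> /derivable1_diffP dh.
by apply: differentiable_comp => //; exact: differentiable_lin_form.
Qed.

Lemma pderiv_ridge beta h (i : 'I_N) u : derivable h (lin_form beta u) 1 ->
  pderiv i (fun v => h (lin_form beta v)) u
  = beta i * h^`()%classic (lin_form beta u).
Proof.
move=> dh; rewrite -deriveZ_dir//; apply: eq_derive_along => s.
by rewrite lin_formDZ.
Qed.

Lemma class_C_ridge beta h k (U : set 'rV[R]_N) : open U -> smooth_fun h ->
  class_C k U (fun v => h (lin_form beta v)).
Proof.
move=> oU; elim: k h => [|k ih] h sh.
  move=> u _; apply: differentiable_continuous; apply: differentiable_ridge.
  exact: (sh 0%N).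
split=> [u _|i]; first by apply: differentiable_ridge; exact: (sh 0%N).
rewrite (_ : pderiv i _
  = fun v => beta i * h^`()%classic (lin_form beta v)).
  apply: class_CM => //; first exact: class_C_cst.
  by apply: ih => j x; rewrite -derive1Sn; exact: sh.
by apply/funext => u; apply: pderiv_ridge; exact: (sh 0%N).
Qed.

End RidgeFunctions.

Section FiberFunctions.
Context {R : realType} {n m : nat}.
Implicit Types (G : 'rV[R]_m -> R) (w : 'rV[R]_(n + m)).

Lemma pderiv_rsubmx_rshift G (a : 'I_m) w :
  pderiv (rshift n a) (fun v => G (rsubmx v)) w = pderiv a G (rsubmx w).
Proof.
apply: eq_derive_along => s; congr (G _); apply/rowP => b.
by rewrite !mxE /= eq_rshift.
Qed.

Lemma pderiv_rsubmx_lshift G (i : 'I_n) w :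
  pderiv (lshift m i) (fun v => G (rsubmx v)) w = 0.
Proof.
rewrite /pderiv (@eq_derive_along _ _ _ _ _ (fun=> G (rsubmx w)) _ _ w 0).
  exact: derive_cst.
move=> s; congr (G _); apply/rowP => b.
by rewrite !mxE /= eq_rlshift mulr0 add0r.
Qed.

Lemma class_C_rsubmx G k (U : set 'rV[R]_m) : class_C k U G ->
  class_C k [set w : 'rV[R]_(n + m) | U (rsubmx w)] (fun w => G (rsubmx w)).
Proof.
elim: k G => [|k ih] G.
  move=> cG w; rewrite inE => Uw.
  apply: continuous_comp; first exact: continuous_rsubmx.
  by apply: cG; rewrite inE.
move=> [dG CG]; split=> [w /= Uw|i].
  apply: differentiable_comp; last exact: dG.
  exact: differentiable_rsubmx.
have [j ->|a ->] := split_ordP i.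
  rewrite (_ : pderiv _ _ = fun=> 0); first exact: class_C_cst.
  by apply/funext => w; exact: pderiv_rsubmx_lshift.
rewrite (_ : pderiv _ _ = fun w => pderiv a G (rsubmx w)); first exact: ih (CG a).
by apply/funext => w; exact: pderiv_rsubmx_rshift.
Qed.

End FiberFunctions.

(** * Christoffel symbols of the warped metric *)

Section WarpedMetric.
Context {R : realType} {n m : nat} (eps alpha : 'I_n -> R) (phi f : R -> R)
  (gF : 'rV[R]_m -> 'M[R]_m) (V : set 'rV[R]_m).
Context (eps2 : forall i, eps i * eps i = 1)
  (smooth_phi : smooth_fun phi) (smooth_f : smooth_fun f)
  (phi_neq0 : forall t, phi t != 0) (f_neq0 : forall t, f t != 0)
  (open_V : open V)
  (diff_gF : forall a b y, V y -> differentiable (fun v => gF v a b) y)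
  (sym_gF : forall y, V y -> (gF y)^T = gF y)
  (unit_gF : forall y, V y -> gF y \in unitmx).

Local Notation xi w := (lin_form alpha (lsubmx w)).
Local Notation fiber w := (rsubmx w).
Local Notation phi' := (phi^`())%classic.
Local Notation phi'' := (phi^`(2))%classic.
Local Notation f' := (f^`())%classic.
Local Notation f'' := (f^`(2))%classic.
Local Notation S := (\sum_i eps i * alpha i ^+ 2).
Implicit Types (t : R) (w : 'rV[R]_(n + m)) (i j k l : 'I_n) (a b c d : 'I_m).

(** The components in one chart of the metric of the warped product: [gF] is
    the local expression of the fiber metric over the open set [V]. *)
Definition warped_metric (w : 'rV[R]_(n + m)) : 'M[R]_(n + m) :=
  block_mx ((phi (xi w) ^+ 2)^-1 *: diag_mx (\row_i eps i)) 0
           0 (f (xi w) ^+ 2 *: gF (fiber w)).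

Local Notation gM := warped_metric.
Local Notation delta i j := ((i == j)%:R : R).

Lemma is_derive_smooth (h : R -> R) t :
  smooth_fun h -> is_derive t 1 h (h^`()%classic t).
Proof. by move=> sh; rewrite derive1E; apply/derivableP; exact: (sh 0%N). Qed.

Lemma smooth_derive1 (h : R -> R) : smooth_fun h -> smooth_fun h^`()%classic.
Proof. by move=> sh k x; rewrite -derive1Sn; exact: sh. Qed.

Lemma is_derive_mul (g h : R -> R) t dg dh :
  is_derive t 1 g dg -> is_derive t 1 h dh ->
  is_derive t 1 (fun x => g x * h x) (dg * h t + g t * dh).
Proof.
move=> gd hd; apply: is_derive_eq (is_deriveM gd hd) _.
by rewrite addrC mulrC.
Qed.

Lemma is_derive_inv (h : R -> R) t dh : h t != 0 ->
  is_derive t 1 h dh -> is_derive t 1 (fun x => (h x)^-1) (- (dh / h t ^+ 2)).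
Proof.
move=> h0 [hd <-]; split; first exact: derivableV.
by rewrite deriveV// scaleNr mulrC.
Qed.

Lemma is_derive_smooth1 (h : R -> R) t :
  smooth_fun h -> is_derive t 1 h^`()%classic (h^`(2)%classic t).
Proof. by move=> /smooth_derive1; exact: is_derive_smooth. Qed.

(** The logarithmic derivative of the conformal factor [1/phi]; the two that
    follow are the logarithmic derivative of [f] and the factor
    [phi^2 f f'] through which the gradient of [f^2 / 2] depends on xi. *)
Definition conf_rate t := - (phi' t / phi t).
Definition warp_rate t := f' t / f t.
Definition warp_grad t := phi t ^+ 2 * (f t * f' t).

Lemma is_derive_conf_factor t :
  is_derive t 1 (fun x => (phi x ^+ 2)^-1) (2 * conf_rate t * (phi t ^+ 2)^-1).
Proof.
have dphi := is_derive_smooth t smooth_phi.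
have := @is_derive_inv (fun x => phi x * phi x) t _
  (mulf_neq0 (phi_neq0 t) (phi_neq0 t)) (is_derive_mul dphi dphi).
move=> /is_derive_eq; apply; rewrite /conf_rate.
move: (phi_neq0 t); set p := phi t; set p' := derive1 _ _ => p0.
by field.
Qed.

Lemma is_derive_warp_factor t :
  is_derive t 1 (fun x => f x ^+ 2) (2 * (f t * f' t)).
Proof.
have df := is_derive_smooth t smooth_f.
by apply: is_derive_eq (is_derive_mul df df) _; rewrite mulrC mulr_natl mulr2n.
Qed.

Lemma is_derive_conf_rate t :
  is_derive t 1 conf_rate ((phi' t / phi t) ^+ 2 - phi'' t / phi t).
Proof.
have dphi := is_derive_smooth t smooth_phi.
have := is_deriveN (is_derive_mul (is_derive_smooth1 t smooth_phi)
  (is_derive_inv (phi_neq0 t) dphi)).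
move=> /is_derive_eq; apply.
move: (phi_neq0 t); set p := phi t; set p' := derive1 _ _.
set p'' := derive1n _ _ _ => p0.
by field.
Qed.

Lemma is_derive_warp_rate t :
  is_derive t 1 warp_rate (f'' t / f t - (f' t / f t) ^+ 2).
Proof.
have df := is_derive_smooth t smooth_f.
have := is_derive_mul (is_derive_smooth1 t smooth_f) (is_derive_inv (f_neq0 t) df).
move=> /is_derive_eq; apply.
move: (f_neq0 t); set p := f t; set p' := derive1 _ _.
set p'' := derive1n _ _ _ => p0.
by field.
Qed.

Lemma is_derive_warp_grad t :
  is_derive t 1 warp_grad
    (2 * phi t * phi' t * (f t * f' t)
     + phi t ^+ 2 * (f' t ^+ 2 + f t * f'' t)).
Proof.
have dphi := is_derive_smooth t smooth_phi.
have df := is_derive_smooth t smooth_f.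
have := is_derive_mul (is_derive_mul dphi dphi)
  (is_derive_mul df (is_derive_smooth1 t smooth_f)).
move=> /is_derive_eq; apply.
set p := phi t; set p' := derive1 _ _; set q := f t; set q' := derive1 _ _.
set q'' := derive1n _ _ _.
by ring.
Qed.

Lemma lin_form_lsubmx w : lin_form alpha (lsubmx w)
  = lin_form (fun i : 'I_(n + m) => row_mx (\row_i alpha i) (0 : 'rV_m) 0 i) w.
Proof.
rewrite /lin_form big_split_ord /= [X in _ = _ + X]big1 ?addr0; last first.
  by move=> a _; rewrite row_mxEr mxE mul0r.
by apply: eq_bigr => i _; rewrite row_mxEl !mxE.
Qed.

(** All components of the metric and all Christoffel symbols are products of a
    function of xi and a function on the fiber.  Base derivatives act on the
    first factor, fiber derivatives on the second. *)
Lemma pderiv_base_fiber_l (h : R -> R) (G : 'rV[R]_m -> R) i w (dh : R) :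
  is_derive (xi w) 1 h dh ->
  pderiv (lshift m i) (fun v => h (xi v) * G (fiber v)) w
  = alpha i * dh * G (fiber w).
Proof.
move=> hd.
have hGd := is_derive_mul hd (is_derive_cst (G (fiber w)) (xi w) 1).
rewrite /pderiv (@eq_derive_along _ _ _ _ _ (fun x => h x * G (fiber w)) _ _
  (xi w) (alpha i)) => [|s].
  rewrite deriveZ_dir; last exact: (@ex_derive _ _ _ _ _ _ _ hGd).
  rewrite derive1E (@derive_val _ _ _ _ _ _ _ hGd).
  by rewrite mulr0 addr0 mulrA.
congr (_ * _); [congr (h _)|congr (G _)].
  by rewrite !lin_form_lsubmx lin_formDZ row_mxEl mxE.
by apply/rowP => b; rewrite !mxE /= eq_rlshift mulr0 add0r.
Qed.

Lemma pderiv_base_fiber_r (h : R -> R) (G : 'rV[R]_m -> R) a w :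
  differentiable G (fiber w) ->
  pderiv (rshift n a) (fun v => h (xi v) * G (fiber v)) w
  = h (xi w) * pderiv a G (fiber w).
Proof.
move=> dG.
rewrite /pderiv (@eq_derive_along _ _ _ _ _ (fun y => h (xi w) * G y) _ _
  (fiber w) (delta_mx 0 a)) => [|s].
  rewrite -[LHS]/(pderiv a _ (fiber w)) pderivM//.
  by rewrite pderiv_cst mul0r add0r.
congr (_ * _); [congr (h _)|congr (G _)].
  by rewrite !lin_form_lsubmx lin_formDZ row_mxEr mxE mulr0 add0r.
by apply/rowP => b; rewrite !mxE /= eq_rshift.
Qed.

Lemma warped_metricll i j w :
  gM w (lshift m i) (lshift m j) = (phi (xi w) ^+ 2)^-1 * (eps i * delta i j).
Proof.
by rewrite /gM block_mxEul !mxE; case: eqVneq => _; rewrite ?mulr1 ?mulr0.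
Qed.

Lemma warped_metriclr i a w : gM w (lshift m i) (rshift n a) = 0.
Proof. by rewrite /gM block_mxEur mxE. Qed.

Lemma warped_metricrl i a w : gM w (rshift n a) (lshift m i) = 0.
Proof. by rewrite /gM block_mxEdl mxE. Qed.

Lemma warped_metricrr a b w :
  gM w (rshift n a) (rshift n b) = f (xi w) ^+ 2 * gF (fiber w) a b.
Proof. by rewrite /gM block_mxEdr mxE. Qed.

Let inv_metric w := block_mx (phi (xi w) ^+ 2 *: diag_mx (\row_i eps i)) 0
  0 ((f (xi w) ^+ 2)^-1 *: invmx (gF (fiber w))).

Lemma mulmx_warped_metric w : V (fiber w) -> gM w *m inv_metric w = 1%:M.
Proof.
move=> Vw; rewrite mulmx_block !mul0mx !mulmx0 !addr0 !add0r.
rewrite -!scalemxAl -!scalemxAr !scalerA mulVf ?expf_neq0// mulfV ?expf_neq0//.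
rewrite !scale1r mulmxV ?unit_gF// mulmx_diag.
rewrite (_ : diag_mx _ = 1%:M) -?scalar_mx_block//.
by rewrite -diag_const_mx; congr diag_mx; apply/rowP => i; rewrite !mxE.
Qed.

Lemma warped_metric_unit w : V (fiber w) -> gM w \in unitmx.
Proof. by move=> /mulmx_warped_metric/mulmx1_unit[]. Qed.

Lemma invmx_warped_metric w : V (fiber w) -> invmx (gM w) = inv_metric w.
Proof.
move=> Vw; rewrite -[RHS](mulKmx (warped_metric_unit Vw)).
by rewrite mulmx_warped_metric// mulmx1.
Qed.

Lemma sum_delta (I : finType) (i : I) (G : I -> R) :
  \sum_k delta k i * G k = G i.
Proof.
rewrite (bigD1 i)//= eqxx mul1r big1 ?addr0// => k /negPf ->.
by rewrite mul0r.
Qed.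

Lemma deltaC (I : finType) (i j : I) : delta i j = delta j i :> R.
Proof. by rewrite eq_sym. Qed.

Lemma mulr_delta (I : finType) (i j : I) (G : I -> R) :
  delta i j * G i = delta i j * G j.
Proof. by case: eqVneq => [->//|]; rewrite !mul0r. Qed.

Lemma pderiv_gM_lll k i j w :
  pderiv (lshift m k) (fun v => gM v (lshift m i) (lshift m j)) w
  = alpha k * (2 * conf_rate (xi w) * (phi (xi w) ^+ 2)^-1) * (eps i * delta i j).
Proof.
under eq_fun do rewrite warped_metricll.
exact: (pderiv_base_fiber_l (fun=> eps i * delta i j) k (is_derive_conf_factor _)).
Qed.

Lemma pderiv_gM_rll a i j w :
  pderiv (rshift n a) (fun v => gM v (lshift m i) (lshift m j)) w = 0.
Proof.
under eq_fun do rewrite warped_metricll.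
rewrite (@pderiv_base_fiber_r (fun x => (phi x ^+ 2)^-1) (fun=> eps i * delta i j))//.
by rewrite pderiv_cst mulr0.
Qed.

Lemma pderiv_gM_lr K i a w :
  pderiv K (fun v => gM v (lshift m i) (rshift n a)) w = 0.
Proof. by under eq_fun do rewrite warped_metriclr; exact: pderiv_cst. Qed.

Lemma pderiv_gM_rl K i a w :
  pderiv K (fun v => gM v (rshift n a) (lshift m i)) w = 0.
Proof. by under eq_fun do rewrite warped_metricrl; exact: pderiv_cst. Qed.

Lemma pderiv_gM_lrr k a b w :
  pderiv (lshift m k) (fun v => gM v (rshift n a) (rshift n b)) w
  = alpha k * (2 * (f (xi w) * f' (xi w))) * gF (fiber w) a b.
Proof.
under eq_fun do rewrite warped_metricrr.
exact: (pderiv_base_fiber_l (fun y => gF y a b) k (is_derive_warp_factor _)).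
Qed.

Lemma pderiv_gM_rrr c a b w : V (fiber w) ->
  pderiv (rshift n c) (fun v => gM v (rshift n a) (rshift n b)) w
  = f (xi w) ^+ 2 * pderiv c (fun y => gF y a b) (fiber w).
Proof.
move=> Vw; under eq_fun do rewrite warped_metricrr.
by apply: (@pderiv_base_fiber_r (fun x => f x ^+ 2) (fun y => gF y a b)); exact: diff_gF.
Qed.

Local Notation dgM := (pderiv_gM_lll, pderiv_gM_rll, pderiv_gM_lr, pderiv_gM_rl,
  pderiv_gM_lrr, pderiv_gM_rrr).

(** The Christoffel symbols of the base are these constants times
    [conf_rate]: the conformal change of a flat metric by [exp (2 s)] has
    symbols linear in [ds], and here [ds] is proportional to [alpha]. *)
Definition conf_symbol k i j : R :=
  delta k i * alpha j + delta k j * alpha i - eps k * eps i * delta i j * alpha k.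

Lemma christoffel_lE k (I J : 'I_(n + m)) w : V (fiber w) ->
  christoffel gM (lshift m k) I J w = 2^-1 * (phi (xi w) ^+ 2 * eps k *
    (pderiv I (fun v => gM v J (lshift m k)) w
     + pderiv J (fun v => gM v I (lshift m k)) w
     - pderiv (lshift m k) (fun v => gM v I J) w)).
Proof.
move=> Vw; rewrite /christoffel invmx_warped_metric//; congr (_ * _).
rewrite big_split_ord /= [X in _ + X]big1 ?addr0; last first.
  by move=> d _; rewrite block_mxEur mxE mul0r.
rewrite (bigD1 k)//= big1 ?addr0; last first.
  by move=> l /negPf lk; rewrite block_mxEul !mxE eq_sym lk mulr0n mulr0 mul0r.
by rewrite block_mxEul !mxE eqxx mulr1n.
Qed.

Lemma christoffel_rE c (I J : 'I_(n + m)) w : V (fiber w) ->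
  christoffel gM (rshift n c) I J w = 2^-1 * \sum_d
    (f (xi w) ^+ 2)^-1 * invmx (gF (fiber w)) c d *
    (pderiv I (fun v => gM v J (rshift n d)) w
     + pderiv J (fun v => gM v I (rshift n d)) w
     - pderiv (rshift n d) (fun v => gM v I J) w).
Proof.
move=> Vw; rewrite /christoffel invmx_warped_metric//; congr (_ * _).
rewrite big_split_ord /= [X in X + _]big1 ?add0r; last first.
  by move=> d _; rewrite block_mxEdl mxE mul0r.
by apply: eq_bigr => d _; rewrite block_mxEdr mxE.
Qed.

Lemma christoffel_lll k i j w : V (fiber w) ->
  christoffel gM (lshift m k) (lshift m i) (lshift m j) w
  = conf_rate (xi w) * conf_symbol k i j.
Proof.
move=> Vw; rewrite christoffel_lE// !dgM /conf_symbol.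
set s := conf_rate _; set p := phi _.
rewrite [eps j * _]mulrC [eps i * delta i k]mulrC.
rewrite (mulr_delta j k eps) (mulr_delta i k eps) (deltaC k i) (deltaC k j).
have p0 : p != 0 := phi_neq0 _.
transitivity (s * ((eps k * eps k) * (delta i k * alpha j + delta j k * alpha i)
    - eps k * eps i * delta i j * alpha k)).
  by field.
by rewrite eps2 mul1r.
Qed.

Lemma christoffel_llr k i a w : V (fiber w) ->
  christoffel gM (lshift m k) (lshift m i) (rshift n a) w = 0.
Proof. by move=> Vw; rewrite christoffel_lE// !dgM !addr0 subr0 !mulr0. Qed.

Lemma christoffel_lrl k i a w : V (fiber w) ->
  christoffel gM (lshift m k) (rshift n a) (lshift m i) w = 0.
Proof. by move=> Vw; rewrite christoffel_lE// !dgM !addr0 subr0 !mulr0. Qed.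

Lemma christoffel_lrr k a b w : V (fiber w) ->
  christoffel gM (lshift m k) (rshift n a) (rshift n b) w
  = warp_grad (xi w) * (- (eps k * alpha k) * gF (fiber w) a b).
Proof.
move=> Vw; rewrite christoffel_lE// !dgM /warp_grad.
set ff := f _; set ff' := derive1 _ _; set p := phi _.
by field.
Qed.

Lemma christoffel_rll c i j w : V (fiber w) ->
  christoffel gM (rshift n c) (lshift m i) (lshift m j) w = 0.
Proof.
move=> Vw; rewrite christoffel_rE// big1 ?mulr0// => d _.
by rewrite !dgM !addr0 subr0 mulr0.
Qed.

Lemma mulVgF c a y : V y -> \sum_d invmx (gF y) c d * gF y d a = delta c a.
Proof.
by move=> Vy; have /matrixP/(_ c a) := mulVmx (unit_gF Vy); rewrite !mxE.
Qed.

Lemma gF_sym a b y : V y -> gF y a b = gF y b a.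
Proof. by move=> Vy; rewrite -[in LHS](sym_gF Vy) mxE. Qed.

Lemma christoffel_rlr c i a w : V (fiber w) ->
  christoffel gM (rshift n c) (lshift m i) (rshift n a) w
  = warp_rate (xi w) * (alpha i * delta c a).
Proof.
move=> Vw; rewrite christoffel_rE// -(mulVgF c a Vw) /warp_rate.
rewrite !mulr_sumr; apply: eq_bigr => d _; rewrite !dgM.
rewrite (gF_sym a d Vw).
have : f (xi w) != 0 by [].
set ff := f _; set ff' := derive1 _ _ => ff0.
by field.
Qed.

Lemma christoffel_rrl c i a w : V (fiber w) ->
  christoffel gM (rshift n c) (rshift n a) (lshift m i) w
  = warp_rate (xi w) * (alpha i * delta c a).
Proof.
move=> Vw; rewrite christoffel_rE// -(mulVgF c a Vw) /warp_rate.
rewrite !mulr_sumr; apply: eq_bigr => d _; rewrite !dgM.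
rewrite (gF_sym a d Vw).
have : f (xi w) != 0 by [].
set ff := f _; set ff' := derive1 _ _ => ff0.
by field.
Qed.

Lemma christoffel_rrr c a b w : V (fiber w) ->
  christoffel gM (rshift n c) (rshift n a) (rshift n b) w
  = christoffel gF c a b (fiber w).
Proof.
move=> Vw; rewrite christoffel_rE//; congr (_ * _).
apply: eq_bigr => d _; rewrite !dgM//.
by field.
Qed.


(** * Ricci tensor of the warped metric *)

Lemma conf_symbolC k i j : conf_symbol k i j = conf_symbol k j i.
Proof.
rewrite /conf_symbol [delta k i * _ + _]addrC; congr (_ - _ * _).
rewrite -!mulrA; congr (_ * _).
by rewrite [LHS]mulrC [RHS]mulrC (deltaC j i) (mulr_delta i j eps).
Qed.

Lemma conf_symbol_diag k i : conf_symbol k i k = alpha i.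
Proof.
have [->|ki] := eqVneq k i; rewrite /conf_symbol !eqxx.
  by rewrite eps2 !mul1r addrAC subrr add0r.
by rewrite (deltaC i k) (negPf ki) !(mul0r, mulr0) subr0 add0r mul1r.
Qed.

(** Each term of [conf_symbol] carries a Kronecker symbol, so a contraction
    with it reduces to three evaluations. *)
Lemma contract_conf_symbol (X : 'I_n -> R) k j :
  \sum_l conf_symbol k j l * X l
  = delta k j * (\sum_l alpha l * X l) + alpha j * X k
    - eps k * eps j * alpha k * X j.
Proof.
rewrite /conf_symbol.
under eq_bigr do rewrite mulrBl mulrDl.
rewrite sumrB big_split /=; congr (_ + _ - _).
- by rewrite mulr_sumr; apply: eq_bigr => l _; rewrite mulrA.
- rewrite -[in RHS](sum_delta k X) mulr_sumr; apply: eq_bigr => l _.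
  by rewrite (deltaC k l) -!mulrA mulrCA.
- rewrite -[in RHS](sum_delta j X) mulr_sumr; apply: eq_bigr => l _.
  by rewrite (deltaC j l); ring.
Qed.

Lemma sum_alpha_conf_symbol i j :
  \sum_k alpha k * conf_symbol k i j
  = 2 * alpha i * alpha j - delta i j * eps i * S.
Proof.
transitivity (\sum_k (delta k i * (alpha k * alpha j)
    + delta k j * (alpha k * alpha i)
    - delta i j * eps i * (eps k * alpha k ^+ 2))).
  by apply: eq_bigr => k _; rewrite /conf_symbol; ring.
rewrite sumrB big_split /= !sum_delta -mulr_sumr.
by ring.
Qed.

(** The quadratic term [Gamma^k_jl Gamma^l_ik] of the Ricci tensor of the
    base, up to [conf_rate ^+ 2]. *)
Lemma sum_conf_symbol2 i j :
  \sum_k \sum_l conf_symbol k j l * conf_symbol l i k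
  = (n%:R + 2) * alpha i * alpha j - 2 * (delta i j * eps i) * S.
Proof.
under eq_bigr => k _.
  rewrite contract_conf_symbol sum_alpha_conf_symbol conf_symbol_diag.
  over.
rewrite sumrB big_split /= sum_delta sumr_const card_ord.
rewrite [X in _ - X](_ : _ = eps j * delta j i * S); last first.
  transitivity (\sum_k (eps j * delta j i * (eps k * alpha k ^+ 2)
      + delta k j * (eps k * eps j * alpha k * alpha i)
      - delta k i * (eps j * eps j * eps k * eps i * alpha k * alpha j))).
    apply: eq_bigr => k _; rewrite /conf_symbol (deltaC j k) (deltaC i k).
    by ring.
  rewrite sumrB big_split /= !sum_delta -mulr_sumr !eps2 !mul1r eps2 !mul1r.
  by rewrite mulrC [alpha i * _]mulrC [in LHS]mulrC; ring.
rewrite (deltaC j i) [eps j * _]mulrC -(mulr_delta i j eps) -mulr_natl.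
by ring.
Qed.

Lemma eq_pderiv_on (F G : 'rV[R]_(n + m) -> R) (K : 'I_(n + m)) w :
  (forall v, V (fiber v) -> F v = G v) -> V (fiber w) ->
  pderiv K F w = pderiv K G w.
Proof.
move=> FG Vw; apply: near_eq_pderiv.
apply: (@filterS _ _ _ [set v | V (fiber v)]) => //.
have := @continuous_rsubmx R 1 n m w; apply.
exact: open_nbhs_nbhs.
Qed.

Lemma pderiv_christoffel_lll l k i j w : V (fiber w) ->
  pderiv (lshift m l)
    (christoffel gM (lshift m k) (lshift m i) (lshift m j)) w
  = alpha l * ((phi' (xi w) / phi (xi w)) ^+ 2 - phi'' (xi w) / phi (xi w))
    * conf_symbol k i j.
Proof.
move=> Vw; rewrite (eq_pderiv_on _ (christoffel_lll k i j))//.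
exact: (pderiv_base_fiber_l (fun=> conf_symbol k i j) l (is_derive_conf_rate _)).
Qed.

Lemma pderiv_christoffel_lll_r a k i j w : V (fiber w) ->
  pderiv (rshift n a)
    (christoffel gM (lshift m k) (lshift m i) (lshift m j)) w = 0.
Proof.
move=> Vw; rewrite (eq_pderiv_on _ (christoffel_lll k i j))//.
rewrite (@pderiv_base_fiber_r conf_rate (fun=> conf_symbol k i j))//.
by rewrite pderiv_cst mulr0.
Qed.

Lemma pderiv_christoffel_llr K k i a w : V (fiber w) ->
  pderiv K (christoffel gM (lshift m k) (lshift m i) (rshift n a)) w = 0.
Proof.
by move=> Vw; rewrite (eq_pderiv_on _ (christoffel_llr k i a))// pderiv_cst.
Qed.

Lemma pderiv_christoffel_lrl K k i a w : V (fiber w) ->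
  pderiv K (christoffel gM (lshift m k) (rshift n a) (lshift m i)) w = 0.
Proof.
by move=> Vw; rewrite (eq_pderiv_on _ (christoffel_lrl k i a))// pderiv_cst.
Qed.

Lemma pderiv_christoffel_rll K c i j w : V (fiber w) ->
  pderiv K (christoffel gM (rshift n c) (lshift m i) (lshift m j)) w = 0.
Proof.
by move=> Vw; rewrite (eq_pderiv_on _ (christoffel_rll c i j))// pderiv_cst.
Qed.

Lemma pderiv_christoffel_lrr l k a b w : V (fiber w) ->
  pderiv (lshift m l)
    (christoffel gM (lshift m k) (rshift n a) (rshift n b)) w
  = alpha l * (2 * phi (xi w) * phi' (xi w) * (f (xi w) * f' (xi w))
     + phi (xi w) ^+ 2 * (f' (xi w) ^+ 2 + f (xi w) * f'' (xi w)))
    * (- (eps k * alpha k) * gF (fiber w) a b).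
Proof.
move=> Vw; rewrite (eq_pderiv_on _ (christoffel_lrr k a b))//.
exact: (pderiv_base_fiber_l (fun y => - (eps k * alpha k) * gF y a b) l
         (is_derive_warp_grad _)).
Qed.

Lemma pderiv_christoffel_rlr j c i a w : V (fiber w) ->
  pderiv (lshift m j)
    (christoffel gM (rshift n c) (lshift m i) (rshift n a)) w
  = alpha j * (f'' (xi w) / f (xi w) - (f' (xi w) / f (xi w)) ^+ 2)
    * (alpha i * delta c a).
Proof.
move=> Vw; rewrite (eq_pderiv_on _ (christoffel_rlr c i a))//.
exact: (pderiv_base_fiber_l (fun=> alpha i * delta c a) j (is_derive_warp_rate _)).
Qed.

Lemma pderiv_christoffel_rlr_r b c i a w : V (fiber w) ->
  pderiv (rshift n b)
    (christoffel gM (rshift n c) (lshift m i) (rshift n a)) w = 0.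
Proof.
move=> Vw; rewrite (eq_pderiv_on _ (christoffel_rlr c i a))//.
rewrite (@pderiv_base_fiber_r warp_rate (fun=> alpha i * delta c a))//.
by rewrite pderiv_cst mulr0.
Qed.

Lemma pderiv_christoffel_rrl_r b c i a w : V (fiber w) ->
  pderiv (rshift n b)
    (christoffel gM (rshift n c) (rshift n a) (lshift m i)) w = 0.
Proof.
move=> Vw; rewrite (eq_pderiv_on _ (christoffel_rrl c i a))//.
rewrite (@pderiv_base_fiber_r warp_rate (fun=> alpha i * delta c a))//.
by rewrite pderiv_cst mulr0.
Qed.

Lemma pderiv_christoffel_rrr d c a b w : V (fiber w) ->
  pderiv (rshift n d)
    (christoffel gM (rshift n c) (rshift n a) (rshift n b)) w
  = pderiv d (christoffel gF c a b) (fiber w).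
Proof.
move=> Vw.
rewrite (@eq_pderiv_on _ (fun v => christoffel gF c a b (fiber v)) _ _
  (christoffel_rrr c a b) Vw).
exact: (pderiv_rsubmx_rshift (christoffel gF c a b)).
Qed.

Lemma pderiv_christoffel_rrr_l i c a b w : V (fiber w) ->
  pderiv (lshift m i)
    (christoffel gM (rshift n c) (rshift n a) (rshift n b)) w = 0.
Proof.
move=> Vw.
rewrite (@eq_pderiv_on _ (fun v => christoffel gF c a b (fiber v)) _ _
  (christoffel_rrr c a b) Vw).
exact: (pderiv_rsubmx_lshift (christoffel gF c a b)).
Qed.

Local Notation christoffelE := (christoffel_lll, christoffel_llr,
  christoffel_lrl, christoffel_lrr, christoffel_rll, christoffel_rlr,
  christoffel_rrl, christoffel_rrr).

(* Here p1, p2, q1, q2 stand for phi'/phi, phi''/phi, f'/f, f''/f, and d, s for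
   d_ij eps_i and S.  The summands are those of the Ricci tensor in the order
   base derivatives, fiber derivatives, then the quadratic terms whose
   first summation index is along the base, and along the fiber. *)
Let base_ricci_identity (p1 p2 q1 q2 x y d s nr mr : R) :
  ((p1 ^+ 2 - p2) * (2 * x * y - d * s) - nr * (y * (p1 ^+ 2 - p2) * x)
   + - (mr * (y * (q2 - q1 ^+ 2) * x)))
  + ((- p1) ^+ 2 * (nr * (2 * x * y - d * s)
                    - ((nr + 2) * x * y - 2 * d * s))
     + (mr * (q1 * (- p1) * (2 * x * y - d * s)) - mr * (q1 ^+ 2 * (x * y))))
  = x * y * ((nr - 2) * p2 - mr * q2 - 2 * mr * p1 * q1)
    + d * s * (p2 - (nr - 1) * p1 ^+ 2 + mr * p1 * q1).
Proof. by ring. Qed.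

(** The three scalar functions of xi in the Ricci tensor: the coefficients of
    [alpha_i alpha_j], of [eps_i d_ij S] and of [- S g_F].  Up to sign and
    powers of [phi] and [f], they are the differential expressions of the
    theorem. *)
Definition hess_coef t : R := (n%:R - 2) * (phi'' t / phi t)
  - m%:R * (f'' t / f t) - 2 * m%:R * (phi' t / phi t) * (f' t / f t).

Definition base_coef t : R := phi'' t / phi t
  - (n%:R - 1) * (phi' t / phi t) ^+ 2 + m%:R * (phi' t / phi t) * (f' t / f t).

Definition fiber_coef t : R := phi t ^+ 2 * (f t * f'' t)
  - (n%:R - 2) * (phi t * phi' t) * (f t * f' t)
  + (m%:R - 1) * phi t ^+ 2 * f' t ^+ 2.

Lemma ricci_ll i j w : V (fiber w) ->
  ricci gM w (lshift m i) (lshift m j)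
  = alpha i * alpha j * hess_coef (xi w)
    + delta i j * eps i * S * base_coef (xi w).
Proof.
move=> Vw; rewrite mxE.
pose p1 : R := phi' (xi w) / phi (xi w).
pose p2 : R := phi'' (xi w) / phi (xi w).
pose q1 : R := f' (xi w) / f (xi w).
pose q2 : R := f'' (xi w) / f (xi w).
pose s2 := 2 * alpha i * alpha j - delta i j * eps i * S.
transitivity (((p1 ^+ 2 - p2) * s2 - n%:R * (alpha j * (p1 ^+ 2 - p2) * alpha i)
   + - (m%:R * (alpha j * (q2 - q1 ^+ 2) * alpha i))
  + (((- p1) ^+ 2 * (n%:R * s2
       - ((n%:R + 2) * alpha i * alpha j - 2 * (delta i j * eps i) * S)))
   + (m%:R * (q1 * (- p1) * s2) - m%:R * (q1 ^+ 2 * (alpha i * alpha j)))))); last first.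
  exact: base_ricci_identity.
congr (_ + _).
  rewrite big_split_ord /=; congr (_ + _).
    under eq_bigr do rewrite !pderiv_christoffel_lll// conf_symbol_diag.
    rewrite sumrB sumr_const card_ord -/p1 -/p2; congr (_ - _).
      rewrite /s2 -sum_alpha_conf_symbol mulr_sumr; apply: eq_bigr => k _.
      by rewrite mulrCA mulrA.
    by rewrite mulr_natl.
  rewrite -mulrN mulr_natl -[X in _ *+ X](card_ord m) -sumr_const.
  apply: eq_bigr => c _.
  by rewrite pderiv_christoffel_rll// pderiv_christoffel_rlr// eqxx mulr1 sub0r.
rewrite big_split_ord /=; congr (_ + _).
  transitivity (\sum_k \sum_l ((- p1) ^+ 2 *
      (conf_symbol k k l * conf_symbol l i j
       - conf_symbol k j l * conf_symbol l i k))).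
    apply: eq_bigr => k _; rewrite big_split_ord /= [X in _ + X]big1 ?addr0.
      by apply: eq_bigr => l _; rewrite !christoffelE// /conf_rate -/p1; ring.
    by move=> d _; rewrite !christoffelE// !(mul0r, mulr0) subr0.
  transitivity ((- p1) ^+ 2 *
      (\sum_k \sum_l conf_symbol k k l * conf_symbol l i j
       - \sum_k \sum_l conf_symbol k j l * conf_symbol l i k)).
    rewrite -sumrB mulr_sumr; apply: eq_bigr => k _.
    by rewrite -sumrB mulr_sumr.
  rewrite sum_conf_symbol2; congr (_ * (_ - _)).
  rewrite -[n in n%:R * s2]card_ord mulr_natl -sumr_const.
  apply: eq_bigr => k _; rewrite /s2 -sum_alpha_conf_symbol.
  by apply: eq_bigr => l _; rewrite conf_symbolC conf_symbol_diag.
transitivity (\sum_(c < m) (\sum_(l < n) q1 * (- p1) * (alpha l * conf_symbol l i j)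
    - \sum_(d < m) delta d c * (q1 ^+ 2 * (alpha i * alpha j) * delta c d))).
  apply: eq_bigr => c _; rewrite big_split_ord /=; congr (_ + _).
    apply: eq_bigr => l _; rewrite !christoffelE// eqxx mulr1n /conf_rate /warp_rate.
    by rewrite -/p1 -/q1; ring.
  rewrite -sumrN; apply: eq_bigr => d _.
  by rewrite !christoffelE// /warp_rate -/q1; ring.
under eq_bigr do rewrite -mulr_sumr sum_alpha_conf_symbol -/s2 sum_delta eqxx mulr1.
by rewrite sumrB !sumr_const card_ord !mulr_natl.
Qed.

Lemma christoffel_fiber_sym c a b y : V y ->
  christoffel gF c a b y = christoffel gF c b a y.
Proof.
move=> Vy; congr (_ * _); apply: eq_bigr => d _; congr (_ * _).
rewrite [X in X - _]addrC; congr (_ - _).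
apply: near_eq_pderiv; apply: (@filterS _ _ _ V); last exact: open_nbhs_nbhs.
by move=> v; exact: gF_sym.
Qed.

(** What is left after the vanishing symbols are removed is a multiple of
    [Gamma^c_ca - Gamma^c_ac] on the fiber. *)
Lemma ricci_lr i a w : V (fiber w) ->
  ricci gM w (lshift m i) (rshift n a) = 0.
Proof.
move=> Vw; rewrite mxE [X in X + _](_ : _ = 0) ?add0r; last first.
  rewrite big_split_ord /= !big1 ?add0r// => [c _|k _].
    by rewrite !pderiv_christoffel_rlr_r// subr0.
  by rewrite pderiv_christoffel_llr// pderiv_christoffel_lll_r// subr0.
rewrite big_split_ord /= [X in X + _]big1 ?add0r; last first.
  move=> k _; rewrite big_split_ord /= !big1 ?addr0// => [d _|l _];
  by rewrite !christoffelE// !(mul0r, mulr0) subr0.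
transitivity (\sum_c \sum_d (delta d a * (warp_rate (xi w) * alpha i *
     christoffel gF c c d (fiber w)) - delta d c * (warp_rate (xi w) * alpha i *
     christoffel gF c a d (fiber w)))).
  apply: eq_bigr => c _; rewrite big_split_ord /= [X in X + _]big1 ?add0r.
    by apply: eq_bigr => d _; rewrite !christoffelE//; ring.
  by move=> l _; rewrite !christoffelE// !(mul0r, mulr0) subr0.
rewrite big1// => c _; rewrite sumrB !sum_delta.
by rewrite (christoffel_fiber_sym c c a Vw) subrr.
Qed.

Lemma ricci_rl i a w : V (fiber w) ->
  ricci gM w (rshift n a) (lshift m i) = 0.
Proof.
move=> Vw; rewrite mxE [X in X + _](_ : _ = 0) ?add0r; last first.
  rewrite big_split_ord /= !big1 ?add0r// => [c _|k _].
    by rewrite pderiv_christoffel_rrl_r// pderiv_christoffel_rrr_l// subr0.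
  by rewrite !pderiv_christoffel_lrl// subr0.
rewrite big_split_ord /= [X in X + _]big1 ?add0r; last first.
  move=> k _; rewrite big_split_ord /= !big1 ?addr0// => [d _|l _];
  by rewrite !christoffelE// !(mul0r, mulr0) subr0.
transitivity (\sum_c \sum_d (delta d a * (warp_rate (xi w) * alpha i *
     christoffel gF c c d (fiber w)) - delta d c * (warp_rate (xi w) * alpha i *
     christoffel gF d a c (fiber w)))).
  apply: eq_bigr => c _; rewrite big_split_ord /= [X in X + _]big1 ?add0r.
    by apply: eq_bigr => d _; rewrite !christoffelE// (deltaC c d); ring.
  by move=> l _; rewrite !christoffelE// !(mul0r, mulr0) subr0.
rewrite big1// => c _; rewrite sumrB !sum_delta.
by rewrite (christoffel_fiber_sym c c a Vw) subrr.
Qed.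

(* Here p, p1, q, q1, q2 stand for phi, phi', f, f', f'', and r1, r2 for the
   derivative and quadratic parts of the Ricci tensor of the fiber. *)
Let fiber_ricci_identity (p p1 q q1 q2 s g r1 r2 nr mr : R) :
  p != 0 -> q != 0 ->
  - ((2 * p * p1 * (q * q1) + p ^+ 2 * (q1 ^+ 2 + q * q2)) * s * g) + r1
  + (- (nr * (- (p1 / p) * (p ^+ 2 * (q * q1)) * s * g))
     + p ^+ 2 * (q * q1) * (q1 / q) * s * g
     + (- (mr * (q1 / q * (p ^+ 2 * (q * q1)) * s * g))
        + q1 / q * (p ^+ 2 * (q * q1)) * s * g + r2))
  = r1 + r2 - s * (p ^+ 2 * (q * q2) - (nr - 2) * (p * p1) * (q * q1)
                   + (mr - 1) * p ^+ 2 * q1 ^+ 2) * g.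
Proof. by move=> p0 q0; field; rewrite q0 p0. Qed.

(** The pure fiber terms reassemble into the Ricci tensor of [gF]; each other
    term has exactly one factor [Gamma^k_ab], hence is a multiple of [gF]. *)
Lemma ricci_rr a b w : V (fiber w) ->
  ricci gM w (rshift n a) (rshift n b)
  = ricci gF (fiber w) a b - S * fiber_coef (xi w) * gF (fiber w) a b.
Proof.
move=> Vw.
pose RF1 := \sum_c (pderiv c (christoffel gF c a b) (fiber w)
                    - pderiv b (christoffel gF c a c) (fiber w)).
pose RF2 := \sum_c \sum_d
  (christoffel gF c c d (fiber w) * christoffel gF d a b (fiber w)
   - christoffel gF c b d (fiber w) * christoffel gF d a c (fiber w)).
have -> : ricci gF (fiber w) a b = RF1 + RF2 by rewrite mxE.
rewrite mxE 2!big_split_ord /=.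
pose dr := 2 * phi (xi w) * phi' (xi w) * (f (xi w) * f' (xi w))
     + phi (xi w) ^+ 2 * (f' (xi w) ^+ 2 + f (xi w) * f'' (xi w)).
pose r := warp_grad (xi w); pose q := warp_rate (xi w).
pose s := conf_rate (xi w); pose g := gF (fiber w) a b.
transitivity (- (dr * S * g) + RF1 + ((- (n%:R * (s * r * S * g)) + r * q * S * g)
   + (- (m%:R * (q * r * S * g)) + q * r * S * g + RF2))); last first.
  exact: fiber_ricci_identity.
congr (_ + _ + (_ + _)).
- under eq_bigr do rewrite pderiv_christoffel_lrr// pderiv_christoffel_lrl// subr0.
  rewrite (mulrAC dr) mulr_sumr -sumrN; apply: eq_bigr => k _.
  by rewrite -/dr -/g; ring.
- by apply: eq_bigr => c _; rewrite !pderiv_christoffel_rrr.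
- transitivity (\sum_k (- (s * r * S * g) + eps k * alpha k ^+ 2 * (r * q * g))).
    apply: eq_bigr => k _; rewrite big_split_ord /=; congr (_ + _).
      rewrite (mulrAC (s * r)) mulr_sumr -sumrN; apply: eq_bigr => l _.
      rewrite !christoffelE// conf_symbolC conf_symbol_diag -/s -/r -/g.
      by ring.
    rewrite (gF_sym a b Vw : g = _) -[gF _ b a](sum_delta a (gF (fiber w) b)) !mulr_sumr.
    apply: eq_bigr => d _; rewrite !christoffelE// -/r -/q.
    by ring.
  rewrite big_split /= sumr_const card_ord -mulr_suml mulNrn mulr_natl.
  by congr (_ + _); ring.
- transitivity (\sum_c (- (q * r * S * g) + delta c b * (q * r * S * gF (fiber w) a c)
    + \sum_d (christoffel gF c c d (fiber w) * christoffel gF d a b (fiber w)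
       - christoffel gF c b d (fiber w) * christoffel gF d a c (fiber w)))).
    apply: eq_bigr => c _; rewrite big_split_ord /=; congr (_ + _).
      transitivity (\sum_l eps l * alpha l ^+ 2 *
          (- (q * r * g) + delta c b * (q * r * gF (fiber w) a c))).
        apply: eq_bigr => l _; rewrite !christoffelE// eqxx mulr1n -/q -/r -/g.
        by ring.
      by rewrite -mulr_suml; ring.
    by apply: eq_bigr => d _; rewrite !christoffelE.
  rewrite !big_split /= sum_delta sumr_const card_ord mulNrn mulr_natl.
  by [].
Qed.
End WarpedMetric.

(** * The warped product is a semi-Riemannian manifold *)

Section Jacobians.
Context {R : realType}.

Lemma differentiable_rV (n m : nat) (T : 'rV[R]_n -> 'rV[R]_m) u :
  (forall j, differentiable (fun v => T v 0 j) u) -> differentiable T u.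
Proof.
move=> dT.
have -> : T = \sum_j (fun v => T v 0 j *: delta_mx 0 j).
  by apply/funext => v; rewrite fct_sumE [LHS]row_sum_delta.
by apply: differentiable_sum => j; apply: differentiableZl.
Qed.

(** Rows of the Jacobian are directional derivatives, and these are computed
    componentwise. *)
Lemma jacobianE (n m : nat) (T : 'rV[R]_n -> 'rV[R]_m) u i j :
  differentiable T u -> 'J T u i j = pderiv i (fun v => T v 0 j) u.
Proof.
move=> dT; have := deriveEjacobian (delta_mx 0 i) dT.
rewrite -rowE derive_mx; last exact: diff_derivable.
by move=> /rowP/(_ j); rewrite !mxE.
Qed.

Lemma cvg_row_mx (X : Type) (D : set_system X) (n m : nat) (g : X -> 'rV[R]_n)
    (h : X -> 'rV[R]_m) (u : 'rV[R]_n) (v : 'rV[R]_m) :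
  Filter D -> g x @[x --> D] --> u -> h x @[x --> D] --> v ->
  row_mx (g x) (h x) @[x --> D] --> row_mx u v.
Proof.
move=> FD gu hv A [P nP PA].
suff H i j : \forall x \near D, P i j (row_mx (g x) (h x) i j).
  have := @filter_forall _ _ _ _ FD (fun i => @filter_forall _ _ _ _ FD (H i)).
  by apply: filterS => x Px; exact: PA.
have := nP i j; have [k ->|b ->] := split_ordP j; rewrite !ord1.
  rewrite row_mxEl => nPk.
  have gk : g x 0 k @[x --> D] --> u 0 k.
    exact: (cvg_comp _ _ gu (@coord_continuous R _ _ _ _ _)).
  apply: (@filterS _ D FD (fun x => P 0 (lshift m k) (g x 0 k))).
    by move=> x; rewrite row_mxEl.
  exact: gk nPk.
rewrite row_mxEr => nPb.
have hb : h x 0 b @[x --> D] --> v 0 b.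
  exact: (cvg_comp _ _ hv (@coord_continuous R _ _ _ _ _)).
apply: (@filterS _ D FD (fun x => P 0 (rshift n b) (h x 0 b))).
  by move=> x; rewrite row_mxEr.
exact: hb nPb.
Qed.

Lemma open_fiber (n m : nat) (V : set 'rV[R]_m) :
  open V -> open [set w : 'rV[R]_(n + m) | V (rsubmx w)].
Proof. by move=> oV; apply: open_comp => // w _; exact: continuous_rsubmx. Qed.

End Jacobians.

Section WarpedProduct.
Context {R : realType} {n m : nat} (eps alpha : 'I_n -> R) (phi f : R -> R)
  (F : metric_atlas R m).
Context (eps2 : forall i, eps i * eps i = 1)
  (smooth_phi : smooth_fun phi) (smooth_f : smooth_fun f)
  (phi_neq0 : forall t, phi t != 0) (f_neq0 : forall t, f t != 0)
  (srF : semi_riemannian F).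

Let B := @conformal R n (pseudo_euclidean eps) (phi \o lin_form alpha).
Let M := @warped_product R n m B (f \o lin_form alpha) F.

Lemma chart_img_warped (c : chart_index M) :
  chart_img c = [set w | chart_img c.2 (rsubmx w)].
Proof.
apply/seteqP; split => [w [[x p] [/= _ cp] <-]|w [p cp pw]].
  by rewrite /= row_mxKr; exists p.
exists (lsubmx w, p) => //=.
by rewrite pw hsubmxK.
Qed.

Lemma transition_dom_warped (c d : chart_index M) :
  transition_dom c d = [set w | transition_dom c.2 d.2 (rsubmx w)].
Proof.
apply/seteqP; split => [w [[x p] [/= [_ cp] [_ dp]] <-]|w [p [cp dp] pw]].
  by rewrite /= row_mxKr; exists p.
exists (lsubmx w, p) => //=.
by rewrite pw hsubmxK.
Qed.

Lemma transition_warped (c d : chart_index M) w :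
  transition c d w = row_mx (lsubmx w) (transition c.2 d.2 (rsubmx w)).
Proof. by []. Qed.

Lemma open_chart_img (a : chart_index F) : open (chart_img a).
Proof. by have [[_ [_ +  _]] _] := srF => /(_ a)[]. Qed.

Lemma class_C_warped_transition (c d : chart_index M) k (j : 'I_(n + m)) :
  class_C k (transition_dom c d) (fun u => transition c d u 0 j).
Proof.
have [[_ [_ _ trF]] _] := srF.
rewrite transition_dom_warped.
have [i ->|b ->] := split_ordP j.
  rewrite (_ : (fun _ => _) = fun w : 'rV_(n + m) => w 0 (lshift m i)).
    exact: class_C_coord.
  by apply/funext => w; rewrite transition_warped row_mxEl mxE.
rewrite (_ : (fun _ => _) = fun w : 'rV_(n + m) => transition c.2 d.2 (rsubmx w) 0 b).
  exact: (class_C_rsubmx (G := fun u => transition c.2 d.2 u 0 b) (trF _ _ _ _)).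
by apply/funext => w; rewrite transition_warped row_mxEr.
Qed.

Lemma smooth_manifold_warped : smooth_manifold M.
Proof.
have [[[[p0 _] hF sF] [covF chF trF]] _] := srF.
split; first split.
- by exists (0, p0).
- by apply: hausdorff_prod => //; exact: norm_hausdorff.
- by apply: second_countable_prod => //; exact: second_countable_rV.
split.
- by move=> [x p]; have [a ap] := covF p; exists (tt, a).
- move=> c; have [od oi can contc contp] := chF c.2; split.
  + by apply: open_setX => //; exact: openT.
  + by rewrite chart_img_warped; exact: open_fiber.
  + move=> [x p]; rewrite inE => -[/= _ cp].
    by rewrite /= row_mxKl row_mxKr can// inE.
  + move=> [x p]; rewrite inE => -[/= _ cp].
    apply: cvg_row_mx; first exact: cvg_fst.
    apply: (cvg_comp _ _ (@cvg_snd _ _ _ _ _)).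
    by apply: contc; rewrite inE.
  + rewrite chart_img_warped => w; rewrite inE => /= cw.
    have cl : lsubmx v @[v --> w] --> lsubmx w := @continuous_lsubmx _ _ _ _ w.
    have cp : param c.2 (rsubmx v) @[v --> w] --> param c.2 (rsubmx w).
      apply: (cvg_comp _ _ (@continuous_rsubmx _ _ _ _ w)).
      by apply: contp; rewrite inE.
    exact: (cvg_pair cl cp).
- by move=> c d j k; exact: class_C_warped_transition.
Qed.

Lemma metric_warped (c : chart_index M) w :
  metric c w = warped_metric eps alpha phi f (metric c.2) w.
Proof. by []. Qed.

(** The base has a single chart, so transitions are the identity on the base
    coordinates. *)
Lemma jacobian_warped_transition (c d : chart_index M) w :
  transition_dom c d w ->
  'J (transition c d) w = block_mx 1%:M 0 0 ('J (transition c.2 d.2) (rsubmx w)).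
Proof.
move=> cdw.
have [[_ [_ _ trF]] _] := srF.
have dT : differentiable (transition c d) w.
  apply: differentiable_rV => j.
  by have [dT _] := class_C_warped_transition c d 1 j; exact: dT.
have dTF : differentiable (transition c.2 d.2) (rsubmx w).
  apply: differentiable_rV => j.
  by have [dTF _] := trF c.2 d.2 j 1%N; apply: dTF;
     rewrite transition_dom_warped in cdw.
apply/matrixP => i j; rewrite jacobianE//.
have [l ->|b ->] := split_ordP j.
  rewrite (_ : (fun _ => _) = fun w : 'rV_(n + m) => w 0 (lshift m l)); last first.
    by apply/funext => v; rewrite transition_warped row_mxEl mxE.
  rewrite pderiv_coord; have [k ->|a ->] := split_ordP i.
    by rewrite block_mxEul mxE eq_lshift eq_sym.
  by rewrite block_mxEdl mxE eq_lrshift.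
rewrite (_ : (fun _ => _) = fun w : 'rV_(n + m) => transition c.2 d.2 (rsubmx w) 0 b).
  2: by apply/funext => v; rewrite transition_warped row_mxEr.
have [k ->|a ->] := split_ordP i.
  by rewrite block_mxEur mxE (pderiv_rsubmx_lshift (fun u => transition c.2 d.2 u 0 b)).
rewrite block_mxEdr (pderiv_rsubmx_rshift (fun u => transition c.2 d.2 u 0 b)).
by rewrite jacobianE.
Qed.

Lemma class_C_warped_metric (c : chart_index M) k i j :
  class_C k (chart_img c) (fun u => metric c u i j).
Proof.
have [_ [smF _ _ _]] := srF.
rewrite chart_img_warped.
have oV : open [set w : 'rV[R]_(n + m) | chart_img c.2 (rsubmx w)].
  exact/open_fiber/open_chart_img.
have ridge h : smooth_fun h ->
    class_C k [set w : 'rV[R]_(n + m) | chart_img c.2 (rsubmx w)]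
      (fun w => h (lin_form alpha (lsubmx w))).
  move=> sh; rewrite (_ : (fun _ => _) = fun w => h (lin_form
    (fun i : 'I_(n + m) => row_mx (\row_i alpha i) (0 : 'rV_m) 0 i) w)).
    exact: class_C_ridge.
  by apply/funext => w; rewrite lin_form_lsubmx.
have [i' ->|a ->] := split_ordP i; have [j' ->|b ->] := split_ordP j.
- rewrite (_ : (fun _ => _) = fun w => (phi (lin_form alpha (lsubmx w))
      * phi (lin_form alpha (lsubmx w)))^-1 * (eps i' * (i' == j')%:R)).
  2: by apply/funext => w; rewrite metric_warped warped_metricll expr2.
  apply: class_CM => //; last exact: class_C_cst.
  apply: class_CV => // [w _|]; first by rewrite mulf_neq0.
  by apply: class_CM => //; exact: ridge.
- rewrite (_ : (fun _ => _) = fun=> 0); first exact: class_C_cst.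
  by apply/funext => w; rewrite metric_warped warped_metriclr.
- rewrite (_ : (fun _ => _) = fun=> 0); first exact: class_C_cst.
  by apply/funext => w; rewrite metric_warped warped_metricrl.
- rewrite (_ : (fun _ => _) = fun w => f (lin_form alpha (lsubmx w))
      * f (lin_form alpha (lsubmx w)) * metric c.2 (rsubmx w) a b).
  2: by apply/funext => w; rewrite metric_warped warped_metricrr expr2.
  apply: class_CM => //; first by apply: class_CM => //; exact: ridge.
  exact: (class_C_rsubmx (G := fun u => metric c.2 u a b) (smF _ _ _ _)).
Qed.

Lemma semi_riemannian_warped : semi_riemannian M.
Proof.
have [_ [smF symF unitF trF]] := srF.
split; first exact: smooth_manifold_warped.
split.
- by move=> c i j k; exact: class_C_warped_metric.
- move=> c w; rewrite chart_img_warped => cw.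
  by rewrite metric_warped tr_block_mx !linearZ /= tr_diag_mx !trmx0 symF.
- move=> c w; rewrite chart_img_warped => cw.
  rewrite metric_warped.
  exact: (@warped_metric_unit _ _ _ _ _ _ _ _ _ eps2 phi_neq0 f_neq0 (unitF c.2)).
move=> c d w cdw J; rewrite /J jacobian_warped_transition// !metric_warped.
rewrite tr_block_mx trmx1 !trmx0 !mulmx_block.
rewrite transition_warped /warped_metric row_mxKl row_mxKr.
rewrite !(mul1mx, mulmx1, mul0mx, mulmx0, addr0, add0r).
rewrite -scalemxAr -scalemxAl; congr block_mx; congr (_ *: _).
by apply: trF; rewrite transition_dom_warped in cdw.
Qed.

End WarpedProduct.

(** * The Einstein condition *)

Section EinsteinWarped.
Context {R : realType} {n m : nat} (eps alpha : 'I_n -> R) (phi f : R -> R)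
  (F : metric_atlas R m) (lamF lam : R).
Context (eps2 : forall i, eps i * eps i = 1) (n_gt1 : (1 < n)%N)
  (m_gt0 : (0 < m)%N) (alpha_neq0 : exists i, alpha i != 0)
  (smooth_phi : smooth_fun phi) (smooth_f : smooth_fun f)
  (phi_neq0 : forall t, phi t != 0) (f_neq0 : forall t, f t != 0)
  (einF : einstein F lamF).

Let B := @conformal R n (pseudo_euclidean eps) (phi \o lin_form alpha).
Let M := @warped_product R n m B (f \o lin_form alpha) F.

Local Notation S := (\sum_i eps i * alpha i ^+ 2).
Local Notation phi' := (phi^`())%classic.
Local Notation phi'' := (phi^`(2))%classic.
Local Notation f' := (f^`())%classic.
Local Notation f'' := (f^`(2))%classic.

Local Notation hess_coef := (@hess_coef R n m phi f).
Local Notation base_coef := (@base_coef R n m phi f).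
Local Notation fiber_coef := (@fiber_coef R n m phi f).

(** Linear independence of [alpha_i alpha_j] and [eps_i d_ij].  Choose [i0]
    with [alpha i0 != 0] and another index [j].  If [alpha j != 0], the
    component [(j, i0)] gives [a = 0]; otherwise [(j, j)] gives [b = 0] and then
    [(i0, i0)] gives [a = 0]. *)
Lemma base_tensor_eq0 (a b : R) :
  (forall i j, alpha i * alpha j * a + (i == j)%:R * eps i * b = 0) <->
  a = 0 /\ b = 0.
Proof.
split=> [ab|[-> ->] i j]; last by rewrite !mulr0 addr0.
have eps0 i : eps i != 0.
  apply/eqP => e0; have := eps2 i; rewrite e0 mul0r => /esym/eqP.
  by rewrite oner_eq0.
have [i0 ai0] := alpha_neq0.
have [j ji] : exists j, j != i0.
  have i1 : (0 < n)%N by exact: ltn_trans n_gt1.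
  case: (eqVneq (Ordinal i1) i0) => [<-|ne]; last by exists (Ordinal i1).
  by exists (Ordinal n_gt1).
have a0 : a = 0.
  have [aj0|aj0] := eqVneq (alpha j) 0.
    have := ab j j; rewrite aj0 !mul0r add0r eqxx mul1r => /eqP.
    rewrite mulf_eq0 (negPf (eps0 j)) => /eqP b0.
    have := ab i0 i0; rewrite b0 mulr0 addr0 => /eqP.
    by rewrite !mulf_eq0 !(negPf ai0) => /eqP.
  have := ab j i0; rewrite (negPf ji) !mul0r addr0 => /eqP.
  by rewrite !mulf_eq0 (negPf ai0) (negPf aj0) => /eqP.
split=> //; have := ab j j; rewrite a0 mulr0 add0r eqxx mul1r => /eqP.
by rewrite mulf_eq0 (negPf (eps0 j)) => /eqP.
Qed.

(** The system is required at every [t] although the Einstein condition is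
    imposed at points: as [alpha] is not zero, xi takes every value. *)
Lemma einstein_warpedP : einstein M lam <->
  forall t, [/\ hess_coef t = 0, S * base_coef t = lam / phi t ^+ 2 &
                lamF - S * fiber_coef t = lam * f t ^+ 2].
Proof.
have [srF ricF] := einF.
have [[[[p0 _] _ _] [covF chF _]] [smF symF unitF _]] := srF.
have oV a : open (chart_img a) := @open_chart_img _ _ _ srF a.
have dF (a : chart_index F) b d y : chart_img a y ->
    differentiable (fun v => metric a v b d) y.
  by move=> ay; have [+ _] := smF a b d 1%N; exact.
have Rll (a : chart_index F) := @ricci_ll _ _ _ eps alpha phi f (metric a)
  (chart_img a) eps2 smooth_phi smooth_f phi_neq0 f_neq0
  (oV a) (dF a) (symF a) (unitF a).
have Rlr (a : chart_index F) := @ricci_lr _ _ _ eps alpha phi f (metric a)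
  (chart_img a) eps2 smooth_phi smooth_f phi_neq0 f_neq0
  (oV a) (dF a) (symF a) (unitF a).
have Rrl (a : chart_index F) := @ricci_rl _ _ _ eps alpha phi f (metric a)
  (chart_img a) eps2 smooth_phi smooth_f phi_neq0 f_neq0
  (oV a) (dF a) (symF a) (unitF a).
have Rrr (a : chart_index F) b d w : chart_img a (rsubmx w) ->
    ricci (warped_metric eps alpha phi f (metric a)) w (rshift n b) (rshift n d)
    = (lamF - S * fiber_coef (lin_form alpha (lsubmx w))) * metric a (rsubmx w) b d.
  move=> aw; rewrite (ricci_rr alpha eps2 smooth_phi smooth_f phi_neq0 f_neq0 (oV a)
    (dF a) (symF a) (unitF a))//.
  by rewrite ricF// mxE -mulrBl.
split=> [[_ ricM] t|eqs].
  (* A point over p0 at which xi equals t. *)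
  have [i0 ai0] := alpha_neq0; have [a ap0] := covF p0.
  pose w : 'rV[R]_(n + m) := row_mx ((t / alpha i0) *: delta_mx 0 i0) (chart a p0).
  have aw : chart_img a (rsubmx w) by rewrite row_mxKr; exists p0.
  have xiw : lin_form alpha (lsubmx w) = t.
    rewrite row_mxKl -[_ *: _]addr0 lin_formDZ divfK// /lin_form big1 ?addr0//.
    by move=> i _; rewrite mxE mulr0.
  have ricw I J : ricci (warped_metric eps alpha phi f (metric a)) w I J
      = lam * warped_metric eps alpha phi f (metric a) w I J.
    have -> : ricci (warped_metric eps alpha phi f (metric a)) w
        = lam *: warped_metric eps alpha phi f (metric a) w.
      by apply: (ricM (tt, a)); rewrite chart_img_warped.
    by rewrite mxE.
  have [h b0] : hess_coef t = 0 /\ S * base_coef t - lam / phi t ^+ 2 = 0.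
    apply/base_tensor_eq0 => i j.
    have := ricw (lshift m i) (lshift m j).
    rewrite Rll// warped_metricll xiw => /eqP.
    rewrite -subr_eq0 => /eqP eq0; rewrite -[RHS]eq0.
    by ring.
  split=> //; first exact: subr0_eq.
  (* Otherwise the fiber metric would vanish at p0, although it is invertible
     and the fiber has positive dimension. *)
  apply/subr0_eq/eqP/negP => /negP ne0.
  have g0 b d : metric a (rsubmx w) b d = 0.
    have := ricw (rshift n b) (rshift n d).
    rewrite Rrr// warped_metricrr xiw mulrA => /eqP.
    by rewrite -subr_eq0 -mulrBl mulf_eq0 (negPf ne0) => /eqP.
  have /matrixP/(_ (Ordinal m_gt0) (Ordinal m_gt0)) := mulmxV (unitF a _ aw).
  rewrite !mxE big1 ?eqxx => [/esym/eqP|d _]; first by rewrite oner_eq0.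
  by rewrite g0 mul0r.
split; first exact: semi_riemannian_warped.
move=> c w cw; have [h1 h2 h3] := eqs (lin_form alpha (lsubmx w)).
have cw' : chart_img c.2 (rsubmx w) by rewrite chart_img_warped in cw.
apply/matrixP => I J; rewrite [RHS]mxE metric_warped.
have [i ->|b ->] := split_ordP I; have [j ->|d ->] := split_ordP J.
- rewrite Rll// h1 mulr0 add0r -mulrA h2.
  by rewrite warped_metricll; ring.
- by rewrite warped_metriclr mulr0 Rlr.
- by rewrite warped_metricrl mulr0 Rrl.
- by rewrite Rrr// h3 warped_metricrr mulrA.
Qed.

End EinsteinWarped.

(** The next three identities relate the components of the Einstein equation,
    on their right-hand sides, to the differential equations. *)
Lemma hess_identity (R : fieldType) (p p1 p2 q q1 q2 a b : R) :
  p != 0 -> q != 0 ->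
  a * q * p2 - b * p * q2 - 2 * b * p1 * q1
  = p * q * (a * (p2 / p) - b * (q2 / q) - 2 * b * (p1 / p) * (q1 / q)).
Proof. by move=> p0 q0; field; rewrite p0 q0. Qed.

Lemma base_identity (R : fieldType) (p p1 p2 q q1 a b s l : R) :
  p != 0 -> q != 0 ->
  s * (q * p * p2 - a * q * p1 ^+ 2 + b * p * p1 * q1) - l * q
  = p ^+ 2 * q * (s * (p2 / p - a * (p1 / p) ^+ 2 + b * (p1 / p) * (q1 / q))
                  - l / p ^+ 2).
Proof. by move=> p0 q0; field; rewrite q0 p0. Qed.

Lemma fiber_identity (R : fieldType) (p p1 q q1 q2 a b s l lF : R) :
  s * (- (q * p ^+ 2 * q2) + a * q * p * p1 * q1 - b * p ^+ 2 * q1 ^+ 2)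
    - (l * q ^+ 2 - lF)
  = lF - s * (p ^+ 2 * (q * q2) - a * (p * p1) * (q * q1) + b * p ^+ 2 * q1 ^+ 2)
    - l * q ^+ 2.
Proof. by ring. Qed.

Lemma eq0_iff_scaled (R : fieldType) (c x y u v : R) :
  c != 0 -> x - y = c * (u - v) -> (x = y) <-> (u = v).
Proof.
move=> c0 e; split=> [xy|uv].
  apply/subr0_eq/eqP; have /eqP := e; rewrite xy subrr eq_sym mulf_eq0.
  by rewrite (negPf c0).
by apply/subr0_eq; rewrite e uv subrr mulr0.
Qed.

Theorem theorem1p2 (R : realType) (n m : nat) (eps alpha : 'I_n -> R)
    (phi f : R -> R) (F : metric_atlas R m) (lamF lam : R)
    (hn : (3 <= n)%N) (hm : (1 <= m)%N)
    (heps : forall i, eps i = 1 \/ eps i = -1)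
    (halpha : exists i, alpha i != 0)
    (hS : (\sum_(i < n) eps i * alpha i ^+ 2 = 1 \/
           \sum_(i < n) eps i * alpha i ^+ 2 = -1) \/
          \sum_(i < n) eps i * alpha i ^+ 2 = 0)
    (hphi : smooth_fun phi) (hf : smooth_fun f)
    (phi_neq0 : forall t, phi t != 0) (f_gt0 : forall t, 0 < f t)
    (hF : einstein F lamF) (hm1 : m = 1%N -> lamF = 0) :
  let S := \sum_(k < n) eps k * alpha k ^+ 2 in
  let xi := fun x : 'rV[R]_n => \sum_(i < n) alpha i * x 0 i in
  let B := @conformal R n (pseudo_euclidean eps) (phi \o xi) in
  let M := @warped_product R n m B (f \o xi) F in
  let phi' := (phi^`())%classic in
  let phi'' := (phi^`(2))%classic in
  let f' := (f^`())%classic in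
  let f'' := (f^`(2))%classic in
  einstein M lam <->
  ((S = 1 \/ S = -1) ->
     (forall t, n.-2%:R * f t * phi'' t - m%:R * phi t * f'' t
                - 2 * m%:R * phi' t * f' t = 0) /\
     (forall t, S * (f t * phi t * phi'' t
                     - n.-1%:R * f t * phi' t ^+ 2
                     + m%:R * phi t * phi' t * f' t) = lam * f t) /\
     (forall t, S * (- (f t * phi t ^+ 2 * f'' t)
                     + n.-2%:R * f t * phi t * phi' t * f' t
                     - m.-1%:R * phi t ^+ 2 * f' t ^+ 2)
                = lam * f t ^+ 2 - lamF)) /\
  (S = 0 ->
     (forall t, n.-2%:R * f t * phi'' t - m%:R * phi t * f'' t
                - 2 * m%:R * phi' t * f' t = 0) /\
     lam = 0 /\ lamF = 0).
Proof.
move=> S xi B M phi1 phi2 f1 f2.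
have eps2 i : eps i * eps i = 1.
  by case: (heps i) => ->; rewrite ?mulr1// mulrNN mulr1.
have f_neq0 t : f t != 0 by rewrite gt_eqF.
have n_gt1 : (1 < n)%N by exact: leq_trans hn.
have nE : n%:R - 2 = n.-2%:R :> R by rewrite -subn2 natrB.
have nE1 : n%:R - 1 = n.-1%:R :> R by rewrite -subn1 natrB// ltnW.
have mE : m%:R - 1 = m.-1%:R :> R by rewrite -subn1 natrB.
have einsteinP : einstein M lam <-> forall t,
    [/\ n.-2%:R * f t * phi2 t - m%:R * phi t * f2 t - 2 * m%:R * phi1 t * f1 t = 0,
        S * (f t * phi t * phi2 t - n.-1%:R * f t * phi1 t ^+ 2
             + m%:R * phi t * phi1 t * f1 t) = lam * f t
      & S * (- (f t * phi t ^+ 2 * f2 t) + n.-2%:R * f t * phi t * phi1 t * f1 t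
             - m.-1%:R * phi t ^+ 2 * f1 t ^+ 2) = lam * f t ^+ 2 - lamF].
  have e1 t : (n.-2%:R * f t * phi2 t - m%:R * phi t * f2 t
      - 2 * m%:R * phi1 t * f1 t = 0) <-> (@hess_coef R n m phi f t = 0).
    apply: (@eq0_iff_scaled _ (phi t * f t)); first by rewrite mulf_neq0.
    by rewrite !subr0 /hess_coef nE; exact: hess_identity.
  have e2 t : (S * (f t * phi t * phi2 t - n.-1%:R * f t * phi1 t ^+ 2
        + m%:R * phi t * phi1 t * f1 t) = lam * f t) <->
      (S * @base_coef R n m phi f t = lam / phi t ^+ 2).
    apply: (@eq0_iff_scaled _ (phi t ^+ 2 * f t)); first by rewrite mulf_neq0// expf_neq0.
    by rewrite /base_coef nE1; exact: base_identity.
  have e3 t : (S * (- (f t * phi t ^+ 2 * f2 t)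
        + n.-2%:R * f t * phi t * phi1 t * f1 t
        - m.-1%:R * phi t ^+ 2 * f1 t ^+ 2) = lam * f t ^+ 2 - lamF) <->
      (lamF - S * @fiber_coef R n m phi f t = lam * f t ^+ 2).
    apply: (@eq0_iff_scaled _ 1); first exact: oner_neq0.
    by rewrite mul1r /fiber_coef nE mE; exact: fiber_identity.
  have EP := @einstein_warpedP R n m eps alpha phi f F lamF lam
    eps2 n_gt1 hm halpha hphi hf phi_neq0 f_neq0 hF.
  by split=> [/EP h t|h]; [|apply/EP => t]; have [h1 h2 h3] := h t;
    split; [apply/e1|apply/e2|apply/e3|apply/e1|apply/e2|apply/e3].
split=> [/einsteinP eqs|[eqs1 eqs0]].
  split=> [_|S0]; first by split; [|split] => t; have [] := eqs t.
  split=> [t|]; first by have [] := eqs t.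
  have [_ /esym/eqP + /esym/eqP] := eqs 0.
  rewrite S0 !mul0r mulf_eq0 (negPf (f_neq0 0)) orbF => /eqP ->.
  by rewrite mul0r sub0r oppr_eq0 => /eqP.
apply/einsteinP => t; case: hS => [S1|S0].
  by have [e1 [e2 e3]] := eqs1 S1.
have [e1 [-> ->]] := eqs0 S0.
by split; rewrite /S ?S0 ?mul0r ?subr0.
Qed.
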